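(* Let $t>0$, and let either (continuous case) $\Omega=\mathcal C_0([0,\infty),\mathbb R^d)$ and $\Omega_t=\mathcal C_0([0,t],\mathbb R^d)$ with the topologies of uniform convergence on compact sets, or (càdlàg case) $\Omega=D([0,\infty),\mathbb R^d)$ with the Skorokhod topology and $\Omega_t=D([0,t),\mathbb R^d)$ with the uniform Skorokhod topology on compact spaces. Then $\mathcal C_b(\Omega_t)$ is isometric to a subspace of $\mathcal C_b(\Omega)$ (for the sup norms). Thus $\mathcal C_b(\Omega_t)$ can be identified with a subset of $\mathcal C_b(\Omega)$.
   Context: $\mathcal C_b(X)$ is the set of bounded continuous real functions on $X$, with $\|f\|_\infty=\sup|f|$. The identification is through $f\mapsto f\circ\Pi_t$, where $\Pi_t:\Omega\to\Omega_t$ is restriction of paths. $\mathcal C_0$ denotes continuous functions vanishing at $0$; $D(I,\mathbb R^d)$ denotes càdlàg functions on $I$. The Skorokhod topology on $D([0,\infty),\mathbb R^d)$ is the usual ($J_1$) topology, metrized by a metric $d_\infty$. The uniform Skorokhod topology on compact spaces on $D([0,t),\mathbb R^d)$ is the one defined by $\hat d(x,y)=d_\infty(x\circ\alpha_t^{-1},y\circ\alpha_t^{-1})$, where $\alpha_t:[0,t)\to[0,\infty)$, $\alpha_t(u)=\frac{u}{t-u}$. *)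

(* Defs.v *)
From HB Require Import structures.
From mathcomp Require Import all_boot all_order all_algebra.
From mathcomp Require Import all_classical all_reals all_analysis.
From mathcomp Require Import ring lra.

Set Implicit Arguments.
Unset Strict Implicit.
Unset Printing Implicit Defensive.

Import Order.TTheory GRing.Theory Num.Theory.
Import numFieldNormedType.Exports.

Local Open Scope classical_set_scope.
Local Open Scope ring_scope.

Section BoundedContinuous.
Context {R : realType} (X : topologicalType).

Definition Cb_pred : {pred X -> R} :=
  mem [set f : X -> R | continuous f /\ bounded_fun f].

Lemma Cb_submod_closed : submod_closed Cb_pred.
Proof.
split=> [|a f g].
  rewrite inE; split; first by move=> x; exact: cvg_cst.
  by exists 0; split=> // M M0 x _ /=; rewrite normr0 ltW.
rewrite !inE => -[cf bf] [cg bg]; split.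
  move=> x; apply: cvgD; last exact: cg.
  by apply: cvgZl_tmp; exact: cf.
have [M [Mr fM]] := bf; have [N [Nr gN]] := bg.
exists (`|a| * (`|M| + 1) + (`|N| + 1)); split; first exact: num_real.
move=> B MB x _ /=; apply: le_trans (ltW MB).
apply: (le_trans (ler_normD _ _)); apply: lerD.
  rewrite normrM ler_wpM2l//; apply: fM => //=.
  by rewrite (le_lt_trans (ler_norm M))// ltrDl.
by apply: gN => //=; rewrite (le_lt_trans (ler_norm N))// ltrDl.
Qed.

HB.instance Definition _ :=
  GRing.isSubmodClosed.Build R (X -> R) Cb_pred Cb_submod_closed.

Record Cb : predArgType := MkCb { Cb_fun :> X -> R ; _ : Cb_fun \in Cb_pred }.

HB.instance Definition _ := [isSub for Cb_fun].
HB.instance Definition _ := [Choice of Cb by <:].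
HB.instance Definition _ := [SubChoice_isSubLmodule of Cb by <:].

(* Applied below to bounded f only: [sup] of an unbounded set is 0. *)
Definition supnorm (f : X -> R) : R := sup (range (fun x => `|f x|)).

End BoundedContinuous.
Arguments Cb R X : clear implicits.

Section Inclusion.
Context {T : Type} (A B : set T).

Lemma inclusion_subproof (AB : A `<=` B) (u : A) : val u \in B.
Proof. by apply/mem_set/AB/set_mem/(valP u). Qed.

Definition inclusion (AB : A `<=` B) (u : A) : B :=
  exist _ (val u) (inclusion_subproof AB u).

End Inclusion.

Section Cadlag.
Context {R : realType} {V : topologicalType}.

(* Limits are taken in the subspace topology of I; at a left endpoint of I the
   left-limit filter is improper, so the second condition holds trivially. *)
Definition cadlag (I : set R) (x : I -> V) :=
  forall s : I,
    x u @[u --> within [set u | val s < val u] (nbhs s)] --> x s /\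
    exists l : V, x u @[u --> within [set u | val u < val s] (nbhs s)] --> l.

Lemma cadlag_comp (I J : set R) (x : I -> V) (phi : J -> I) :
  continuous phi ->
  (forall u v, val u < val v -> val (phi u) < val (phi v)) ->
  cadlag x -> cadlag (x \o phi).
Proof.
move=> cphi mphi cx s; have [rx [l lx]] := cx (phi s); split=> [|].
  apply: cvg_trans rx => P /= nP.
  suff : nbhs s [set u | val s < val u -> P (x (phi u))] by [].
  have := cphi s [set v | val (phi s) < val v -> P (x v)] nP.
  by apply: (@filterS _ (nbhs s)) => u /= + su; apply; exact: mphi.
exists l; apply: cvg_trans lx => P /= nP.
suff : nbhs s [set u | val u < val s -> P (x (phi u))] by [].
have := cphi s [set v | val v < val (phi s) -> P (x v)] nP.
by apply: (@filterS _ (nbhs s)) => u /= + su; apply; exact: mphi.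
Qed.

End Cadlag.

Section Skorokhod.
Context {R : realType} {V : normedModType R}.
Implicit Types (x y z : R -> V) (l : R -> R) (T s u e : R).

Definition time_change T l :=
  [/\ {in `[0, T] &, {homo l : s u / s < u}},
      {within `[0, T], continuous l} &
      l @` `[0, T]%classic = `[0, T]%classic].

(* Billingsley's Skorokhod distance on [0, T] is the infimum of these e. *)
Definition skorokhod_eps T x y : set R :=
  [set e | 0 < e /\ exists2 l, time_change T l &
     forall s, s \in `[0, T] -> `|l s - s| <= e /\ `|x s - y (l s)| <= e].

Definition skorokhod_dist T x y : R := inf (skorokhod_eps T x y).

Lemma time_change_id T : time_change T id.
Proof.
split; first by [].
  by apply: continuous_subspaceT => x; exact: cvg_id.
by rewrite image_id.
Qed.

Lemma time_change_in T l s : time_change T l -> s \in `[0, T] -> l s \in `[0, T].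
Proof.
move=> [_ _ lT] sT.
by have : `[0, T]%classic (l s) by rewrite -lT; exists s.
Qed.

Lemma time_change_onto T l s : time_change T l -> s \in `[0, T] ->
  exists2 u, u \in `[0, T] & l u = s.
Proof.
move=> [_ _ lT] sT.
have : (l @` `[0, T]) s by rewrite lT.
by move=> -[u uT <-]; exists u.
Qed.

Lemma time_change_build T l : 0 <= T ->
  {in `[0, T] &, {homo l : s u / s < u}} ->
  l @` `[0, T]%classic = `[0, T]%classic -> time_change T l.
Proof.
move=> T0 il lT; split => //.
have lin s : s \in `[0, T] -> l s \in `[0, T].
  by move=> sT; have : `[0, T]%classic (l s) by rewrite -lT; exists s.
have O_in : 0 \in `[0, T] by rewrite in_itv/= lexx.
have T_in : T \in `[0, T] by rewrite in_itv/= lexx T0.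
have l0 : l 0 = 0.
  have [s sT s0] : (l @` `[0, T]) 0 by rewrite lT.
  have /andP[s_ge0 _] : 0 <= s <= T by [].
  have [s_gt0|s_le0] := ltP 0 s; last first.
    have sE : s = 0 by apply/eqP; rewrite eq_le s_le0 s_ge0.
    by rewrite -{1}sE.
  have := il _ _ O_in sT s_gt0; rewrite s0 ltNge.
  by have := lin _ O_in; rewrite in_itv/= => /andP[-> _].
have lTT : l T = T.
  have [s sT s0] : (l @` `[0, T]) T by rewrite lT.
  have /andP[_ s_leT] : 0 <= s <= T by [].
  have [s_ltT|s_geT] := ltP s T; last first.
    have sE : s = T by apply/eqP; rewrite eq_le s_leT s_geT.
    by rewrite -{1}sE.
  have := il _ _ sT T_in s_ltT; rewrite s0 ltNge.
  by have := lin _ T_in; rewrite in_itv/= => /andP[_ ->].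
apply: segment_inc_surj_continuous; first exact: le_mono_in.
by rewrite l0 lTT => s /= sT; rewrite -/(`[0, T]%classic s) -lT in sT.
Qed.

Lemma time_change_comp T l k : 0 <= T -> time_change T l -> time_change T k ->
  time_change T (k \o l).
Proof.
move=> T0 tl tk; have [il cl lT] := tl; have [ik ck kT] := tk.
apply: time_change_build => //.
  move=> s u sT uT su; apply: ik; last exact: il.
    exact: time_change_in tl sT.
  exact: time_change_in tl uT.
by rewrite -image_comp lT kT.
Qed.

Lemma time_change_inv T l : 0 <= T -> time_change T l ->
  exists2 k, time_change T k & {in `[0, T], cancel k l}.
Proof.
move=> T0 tl; have [il cl lT] := tl.
have /choice[k kP] : forall s, exists u, s \in `[0, T] -> u \in `[0, T] /\ l u = s.
  move=> s; have [sT|] := boolP (s \in `[0, T]); last by exists 0.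
  by have [u uT us] := time_change_onto tl sT; exists u.
have lmono := le_mono_in il.
exists k; last by move=> s /kP[].
apply: time_change_build => //.
  move=> s u sT uT; have [ks lks] := kP _ sT; have [ku lku] := kP _ uT.
  by rewrite -{1}lks -{1}lku (leW_mono_in lmono).
apply/seteqP; split => [_ [s sT <-]|s sT] /=; first exact: (kP _ sT).1.
have lsT := time_change_in tl sT; exists (l s) => //.
have [kls lkl] := kP _ lsT.
exact: (inc_inj_in lmono).
Qed.

Lemma skorokhod_eps_refl T x e : 0 < e -> skorokhod_eps T x x e.
Proof.
move=> e0; split => //; exists id; first exact: time_change_id.
by move=> s _; rewrite !subrr !normr0 ltW.
Qed.

Lemma skorokhod_eps_sym T x y : 0 <= T -> skorokhod_eps T x y `<=` skorokhod_eps T y x.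
Proof.
move=> T0 e [e0 [l tl le]]; split => //.
have [k tk kK] := time_change_inv T0 tl; exists k => // s sT.
have [] := le _ (time_change_in tk sT).
by rewrite kK// distrC [X in _ -> X <= _ -> _]distrC.
Qed.

Lemma skorokhod_eps_triangle T x y z a b : 0 <= T ->
  skorokhod_eps T x y a -> skorokhod_eps T y z b -> skorokhod_eps T x z (a + b).
Proof.
move=> T0 [a0 [l tl la]] [b0 [k tk kb]]; split; first exact: addr_gt0.
exists (k \o l); first exact: time_change_comp.
move=> s sT; have [la1 la2] := la _ sT.
have [kb1 kb2] := kb _ (time_change_in tl sT); split => /=.
  by rewrite (le_trans (ler_distD (l s) _ _))// addrC lerD.
by rewrite (le_trans (ler_distD (y (l s)) _ _))// lerD.
Qed.

Lemma skorokhod_eps_bounded T x y M :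
  (forall s, s \in `[0, T] -> `|x s| <= M) ->
  (forall s, s \in `[0, T] -> `|y s| <= M) -> skorokhod_eps T x y !=set0.
Proof.
move=> xM yM; exists (`|M| + `|M| + 1); split.
  by rewrite ltr_wpDl// addr_ge0.
exists id; first exact: time_change_id.
move=> s sT; rewrite subrr normr0; split; first by rewrite !addr_ge0.
rewrite (le_trans (ler_normB _ _))// -[leLHS]addr0 lerD// lerD//.
  by rewrite (le_trans (xM _ sT))// ler_norm.
by rewrite (le_trans (yM _ sT))// ler_norm.
Qed.

Lemma skorokhod_eps_lbound T x y : lbound (skorokhod_eps T x y) 0.
Proof. by move=> e [/ltW]. Qed.

Lemma skorokhod_dist_ge0 T x y : 0 <= skorokhod_dist T x y.
Proof.
rewrite /skorokhod_dist.
have [->|/set0P ne] := eqVneq (skorokhod_eps T x y) set0; first by rewrite inf0.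
by apply: lb_le_inf => //; exact: skorokhod_eps_lbound.
Qed.

Lemma skorokhod_dist_le T x y e : skorokhod_eps T x y e -> skorokhod_dist T x y <= e.
Proof. by move=> ?; apply: ge_inf => //; exists 0; exact: skorokhod_eps_lbound. Qed.

Lemma skorokhod_distxx T x : skorokhod_dist T x x = 0.
Proof.
apply/eqP; rewrite eq_le skorokhod_dist_ge0 andbT; apply/ler_addgt0Pl => e e0.
by rewrite addr0 skorokhod_dist_le//; exact: skorokhod_eps_refl.
Qed.

Lemma skorokhod_dist_sym T x y : 0 <= T -> skorokhod_dist T x y = skorokhod_dist T y x.
Proof.
by move=> T0; congr inf; apply/seteqP; split; exact: skorokhod_eps_sym.
Qed.

Lemma skorokhod_dist_lt T x y e : skorokhod_eps T x y !=set0 ->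
  skorokhod_dist T x y < e -> exists2 a, skorokhod_eps T x y a & a < e.
Proof.
by move=> ne; exact: inf_lt.
Qed.

Lemma skorokhod_dist_triangle T x y z : 0 <= T ->
  skorokhod_eps T x y !=set0 -> skorokhod_eps T y z !=set0 ->
  skorokhod_dist T x z <= skorokhod_dist T x y + skorokhod_dist T y z.
Proof.
move=> T0 nxy nyz; apply/ler_addgt0Pl => e e0.
have e20 : 0 < e / 2 by rewrite divr_gt0.
have [|a axy ae] := @skorokhod_dist_lt _ _ _ (skorokhod_dist T x y + e / 2) nxy.
  by rewrite ltrDl.
have [|b byz be] := @skorokhod_dist_lt _ _ _ (skorokhod_dist T y z + e / 2) nyz.
  by rewrite ltrDl.
have := skorokhod_dist_le (skorokhod_eps_triangle T0 axy byz).
by lra.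
Qed.

End Skorokhod.

Section SkorokhodMetric.
Context {R : realType} {V : normedModType R}.
Implicit Types (x y z : `[(0 : R), +oo[%classic -> V) (m : nat) (s u e : R).

(* 1 on [0, m - 1], m - s on [m - 1, m], 0 on [m, +oo[ *)
Definition cutoff m s : R := Num.max 0 (Num.min 1 (m%:R - s)).

Definition cut_path m x (s : R) : V := cutoff m s *: 'valL_0 x s.

(* Billingsley's metric for the J1 topology on D([0, +oo[):
     d_oo(x, y) = \sum_(m >= 1) 2^-m min(1, d_m(x^m, y^m)),
   where x^m = cutoff m * x and d_m is the Skorokhod distance on [0, m]. *)
Definition skorokhod_term x y m : R :=
  Num.min 1 (skorokhod_dist m%:R (cut_path m x) (cut_path m y)) / 2 ^+ m.

Definition skorokhod_metric x y : R :=
  limn (series (fun m => skorokhod_term x y m.+1)).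

Lemma valL_val (I : set R) (v : V) (x : I -> V) (u : I) : 'valL_v x (val u) = x u.
Proof.
have uE : set_val u = val u by rewrite set_valE.
by rewrite -uE; have /(congr1 (fun f => f u)) := valLK v x.
Qed.

Lemma in_nneg s : 0 <= s -> exists u : `[(0 : R), +oo[%classic, val u = s.
Proof.
move=> s0; have sI : s \in `[(0 : R), +oo[%classic by rewrite inE/= in_itv/= s0.
by exists (exist _ s sI).
Qed.

Lemma nbhs_set_type (I : set R) (s : I) (P : set I) : nbhs s P ->
  exists2 e : R, 0 < e & forall u : I, `|val s - val u| < e -> P u.
Proof.
move=> /nbhs_ballP[e e0 eP]; exists e => // u su; exact: eP.
Qed.

Lemma cadlag_right x s e : cadlag x -> 0 <= s -> 0 < e ->
  exists2 b, 0 < b &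
    forall u, s <= u < s + b -> `|'valL_0 x s - 'valL_0 x u| < e.
Proof.
move=> cx /in_nneg[s' <-] e0.
have [/cvgrPdist_lt/(_ _ e0) + _] := cx s'.
move=> /(@nbhs_set_type _ s' [set u | _ -> _])[b b0 bP]; exists b => // u /andP[su ub].
have u0 : 0 <= u.
  have := set_mem (valP s'); rewrite /= in_itv/= andbT => /le_trans; exact.
have [u' u'E] := in_nneg u0; rewrite -u'E !valL_val.
have [su'|us'] := ltP (val s') (val u').
  apply: bP => //; rewrite distrC ger0_norm ?subr_ge0 ?u'E//.
  by rewrite ltrBlDl.
suff -> : u' = s' by rewrite subrr normr0.
by apply/val_inj/eqP; rewrite eq_le us' u'E su.
Qed.

Lemma cadlag_bounded x T : cadlag x ->
  exists M, forall s, s \in `[0, T] -> `|'valL_0 x s| <= M.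
Proof.
move=> cx.
have locb (s : R) : `[0, T]%classic s -> exists b M, 0 < b /\
    forall u, 0 <= u -> `|s - u| < b -> `|'valL_0 x u| <= M.
  move=> sT; have s0 : 0 <= s by move: sT; rewrite /= in_itv/= => /andP[].
  have [s' s'E] := in_nneg s0.
  have [/cvgrPdist_lt/(_ _ ltr01)/nbhs_set_type[b1 b10 b1P]] := cx s'.
  move=> [l /cvgrPdist_lt/(_ _ ltr01)/nbhs_set_type[b2 b20 b2P]].
  exists (Num.min b1 b2), (Num.max `|'valL_0 x s| (Num.max `|x s'| `|l| + 1)).
  split; first by rewrite lt_min b10 b20.
  move=> u u0; have [u' u'E] := in_nneg u0.
  rewrite -s'E -u'E (valL_val 0 x s') (valL_val 0 x u') lt_min => /andP[su1 su2].
  have [su|us|/val_inj <-] := ltgtP (val s') (val u').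
  - have := b1P _ su1 su => xx; rewrite !le_max; apply/orP; right.
    have := ler_normB (x s') (x s' - x u'); rewrite subKr => h.
    by rewrite (le_trans h)// lerD ?le_max ?lexx// ltW.
  - have := b2P _ su2 us => xx; rewrite !le_max; apply/orP; right.
    have := ler_normB l (l - x u'); rewrite subKr => h.
    by rewrite (le_trans h)// lerD ?le_max ?lexx ?orbT// ltW.
  - by rewrite le_max lexx.
have := @segment_compact R 0 T => /compact_near_coveringP.
move=> /(_ R +oo (fun M u => 0 <= u -> `|'valL_0 x u| <= M) _)[].
  move=> s /locb[b [M [b0 bM]]].
  exists (ball s b, [set M' | M <= M']).
    split; first exact: nbhsx_ballx.
    by apply: nbhs_pinfty_ge; exact: num_real.
  by move=> [u M'] /= [su MM'] u0; exact: le_trans (bM _ u0 su) MM'.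
move=> M [_ MP]; exists (M + 1) => s sT.
have /MP : M < M + 1 by rewrite ltrDl.
by apply=> //; move: sT; rewrite in_itv/= => /andP[].
Qed.

Lemma cutoff_ge0 m s : 0 <= cutoff m s.
Proof. by rewrite le_max lexx. Qed.

Lemma cutoff_le1 m s : cutoff m s <= 1.
Proof. by rewrite ge_max ler01 ge_min lexx. Qed.

Lemma cutoff1 m s : s + 1 <= m%:R -> cutoff m s = 1.
Proof.
move=> sm; rewrite /cutoff min_l; first by rewrite max_r.
by rewrite lerBrDl.
Qed.

Lemma skorokhod_eps_cadlag m x y : cadlag x -> cadlag y ->
  skorokhod_eps m%:R (cut_path m x) (cut_path m y) !=set0.
Proof.
move=> /cadlag_bounded-/(_ m%:R)[M xM] /cadlag_bounded-/(_ m%:R)[N yN].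
have H w B : (forall s, s \in `[0, m%:R] -> `|'valL_0 w s| <= B) ->
    forall s, s \in `[0, m%:R] -> `|cut_path m w s| <= B.
  move=> wB s sm; rewrite normrZ ger0_norm ?cutoff_ge0//.
  by rewrite (le_trans _ (wB _ sm))// ler_piMl// cutoff_le1.
apply: (@skorokhod_eps_bounded _ _ _ _ _ (Num.max M N)).
  by move=> s sm; rewrite le_max (H _ _ xM).
by move=> s sm; rewrite le_max (H _ _ yN)// orbT.
Qed.

Lemma skorokhod_term_ge0 x y m : 0 <= skorokhod_term x y m.
Proof.
by rewrite divr_ge0// ?exprn_ge0// le_min ler01 skorokhod_dist_ge0.
Qed.

Lemma is_cvg_skorokhod x y : cvgn (series (fun m => skorokhod_term x y m.+1)).
Proof.
apply: (@series_le_cvg _ _ (geometric 1 2^-1)).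
- by move=> m; exact: skorokhod_term_ge0.
- by move=> m; rewrite /geometric/= mul1r exprn_ge0.
- move=> m; rewrite /geometric/= mul1r /skorokhod_term exprVn.
  apply: (@le_trans _ _ (1 / 2 ^+ m.+1)).
    by rewrite ler_wpM2r ?invr_ge0 ?exprn_ge0// ge_min lexx.
  by rewrite mul1r lef_pV2 ?posrE ?exprn_gt0// ler_eXn2l// ltr1n.
- by apply: is_cvg_geometric_series; rewrite ger0_norm// invf_lt1// ltr1n.
Qed.

Lemma skorokhod_metricxx x : skorokhod_metric x x = 0.
Proof.
rewrite /skorokhod_metric (_ : (fun m => _) = fun=> 0).
  rewrite (_ : series _ = fun=> 0) ?lim_cst//.
  by apply/funext => n; rewrite /series/= big1.
by apply/funext => m; rewrite /skorokhod_term skorokhod_distxx min_r// mul0r.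
Qed.

Lemma skorokhod_metric_sym x y : skorokhod_metric x y = skorokhod_metric y x.
Proof.
rewrite /skorokhod_metric (_ : (fun m => _) = fun m => skorokhod_term y x m.+1)//.
by apply/funext => m; rewrite /skorokhod_term skorokhod_dist_sym.
Qed.

Lemma skorokhod_metric_triangle x y z : cadlag x -> cadlag y -> cadlag z ->
  skorokhod_metric x z <= skorokhod_metric x y + skorokhod_metric y z.
Proof.
move=> cx cy cz; rewrite /skorokhod_metric -lim_seriesD; try exact: is_cvg_skorokhod.
apply: lim_series_le; first exact: is_cvg_skorokhod.
  by apply: is_cvg_seriesD; exact: is_cvg_skorokhod.
move=> m; change (skorokhod_term x z m.+1 <=
  skorokhod_term x y m.+1 + skorokhod_term y z m.+1).
rewrite /skorokhod_term -mulrDl ler_wpM2r ?invr_ge0 ?exprn_ge0//.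
have := @skorokhod_dist_triangle _ _ m.+1%:R (cut_path m.+1 x) (cut_path m.+1 y)
  (cut_path m.+1 z) (ler0n _ _) (skorokhod_eps_cadlag m.+1 cx cy)
  (skorokhod_eps_cadlag m.+1 cy cz).
have := @skorokhod_dist_ge0 _ _ m.+1%:R (cut_path m.+1 x) (cut_path m.+1 y).
have := @skorokhod_dist_ge0 _ _ m.+1%:R (cut_path m.+1 y) (cut_path m.+1 z).
move: (skorokhod_dist _ _ _) (skorokhod_dist _ _ _) (skorokhod_dist _ _ _).
move=> a b c c0 b0 abc.
by case: (leP 1 a) => ?; case: (leP 1 b) => ?; case: (leP 1 c) => ?; lra.
Qed.

Lemma skorokhod_metric_positivity x y : cadlag x -> cadlag y ->
  skorokhod_metric x y = 0 -> x = y.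
Proof.
move=> cx cy d0.
have dist0 m : skorokhod_dist m.+1%:R (cut_path m.+1 x) (cut_path m.+1 y) = 0.
  have : skorokhod_term x y m.+1 <= 0.
    rewrite -d0 (@le_trans _ _ (series (fun m => skorokhod_term x y m.+1) m.+1))//.
      rewrite /series/= big_nat_recr//= lerDr sumr_ge0// => i _.
      exact: skorokhod_term_ge0.
    apply: nondecreasing_cvgn_le; last exact: is_cvg_skorokhod.
    by apply: nondecreasing_series => n _ _; exact: skorokhod_term_ge0.
  rewrite /skorokhod_term pmulr_lle0 ?invr_gt0 ?exprn_gt0// ge_min leNgt ltr01/=.
  by move=> h; apply/eqP; rewrite eq_le h skorokhod_dist_ge0.
apply/funext => s'; rewrite -!(valL_val 0).
have s0 : 0 <= val s' by have := set_mem (valP s'); rewrite /= in_itv/= andbT.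
move: (val s') s0 => {s'} s s0.
apply/eqP; rewrite -subr_eq0 -normr_le0; apply/ler_addgt0Pl => e e0; rewrite addr0.
have e30 : 0 < e / 3 by rewrite divr_gt0.
have [b1 b10 b1P] := cadlag_right cx s0 e30.
have [b2 b20 b2P] := cadlag_right cy s0 e30.
pose b := Num.min 1 (Num.min b1 b2).
have b_gt0 : 0 < b by rewrite !lt_min ltr01 b10 b20.
have [b_1 b_b1 b_b2] : [/\ b <= 1, b <= b1 & b <= b2].
  by split; rewrite !ge_min lexx ?orbT.
pose m := Num.truncn (s + 2).
have ms : s + 2 < m.+1%:R by exact: truncnS_gt.
have : skorokhod_dist m.+1%:R (cut_path m.+1 x) (cut_path m.+1 y) <
    Num.min (b / 4) (e / 3).
  by rewrite dist0 lt_min e30 divr_gt0.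
move=> /(skorokhod_dist_lt (skorokhod_eps_cadlag m.+1 cx cy)).
move=> [a [a0 [l tl lP]]]; rewrite lt_min => /andP[ab ae].
pose u := s + b / 2.
have um : u \in `[0, m.+1%:R] by rewrite in_itv/= /u; apply/andP; split; lra.
have [lu xyu] := lP _ um.
have {}lu := le_lt_trans lu ab; have {}xyu := le_lt_trans xyu ae.
move: lu; rewrite ltr_distl => /andP[lu1 lu2].
have /b1P xu : s <= u < s + b1 by rewrite /u; apply/andP; split; lra.
have /b2P yu : s <= l u < s + b2 by rewrite /u in lu1 lu2 *; apply/andP; split; lra.
move: xyu; rewrite /cut_path !cutoff1 ?scale1r; [|rewrite /u in lu2 *; lra..] => xyu.
have := ler_distD ('valL_0 x u) ('valL_0 x s) ('valL_0 y s).
have := ler_distD ('valL_0 y (l u)) ('valL_0 x u) ('valL_0 y s).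
rewrite [`|'valL_0 y (l u) - _|]distrC.
by lra.
Qed.

End SkorokhodMetric.

Section SetTypeContinuity.
Context {R : realType}.
Implicit Types I J : set R.

Lemma val_continuous I : continuous (fun u : I => val u).
Proof.
have -> : (fun u : I => val u) = set_val by rewrite set_valE.
exact: (@initial_continuous I R set_val).
Qed.

Lemma continuous_set_type (X : topologicalType) I (phi : X -> I) :
  continuous (fun u => val (phi u)) -> continuous phi.
Proof.
move=> cphi; apply: (@continuous_comp_initial I X R set_val).
suff -> : set_val \o phi = (fun u => val (phi u)) by [].
by rewrite set_valE.
Qed.

Lemma inclusion_continuous J I (JI : J `<=` I) : continuous (inclusion JI).
Proof. by apply: continuous_set_type; exact: val_continuous. Qed.

End SetTypeContinuity.

Section PathSpaces.
Context {R : realType} (d : nat).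

(* [set_type] carries the subspace topology, [{family compact, _ -> _}] that of
   uniform convergence on compact sets. The norm of 'rV[R]_d is the max norm. *)
Definition C0 (I : set R) : Type :=
  set_type [set x : {family compact, I -> 'rV[R]_d} |
    continuous (x : I -> 'rV[R]_d) /\ forall u : I, val u = 0 -> x u = 0].

HB.instance Definition _ (I : set R) := Topological.on (C0 I).

Definition D (I : set R) : Type := set_type [set x : I -> 'rV[R]_d | cadlag x].

HB.instance Definition _ (I : set R) := Choice.on (D I).

Lemma D_cadlag (I : set R) (x : D I) : cadlag (val x).
Proof. exact: set_mem (valP x). Qed.

Lemma D_comp_subproof (I J : set R) (phi : J -> I) (cphi : continuous phi)
    (mphi : forall u v, val u < val v -> val (phi u) < val (phi v)) (x : D I) :
  val x \o phi \in [set x : J -> 'rV[R]_d | cadlag x].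
Proof. by apply/mem_set/cadlag_comp => //; exact: D_cadlag. Qed.

Definition D_comp (I J : set R) (phi : J -> I) (cphi : continuous phi)
    (mphi : forall u v, val u < val v -> val (phi u) < val (phi v)) (x : D I) : D J :=
  exist _ (val x \o phi) (D_comp_subproof cphi mphi x).

(* D([0, +oo[, R^d); a separate constant from D, so that it can carry the J1
   metric while D([0, t[, R^d) carries another one. *)
Definition D_infty : Type := D `[0, +oo[.

HB.instance Definition _ := Choice.on D_infty.

Definition d_infty (x y : D_infty) : R := skorokhod_metric (val x) (val y).

Lemma d_inftyxx x : d_infty x x = 0. Proof. exact: skorokhod_metricxx. Qed.

Lemma d_infty_positivity x y : d_infty x y = 0 -> x = y.
Proof.
by move=> /skorokhod_metric_positivity h; apply/val_inj/h; exact: D_cadlag.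
Qed.

Lemma d_infty_sym x y : d_infty x y = d_infty y x.
Proof. exact: skorokhod_metric_sym. Qed.

Lemma d_infty_triangle y x z : d_infty x z <= d_infty x y + d_infty y z.
Proof. by apply: skorokhod_metric_triangle; exact: D_cadlag. Qed.

HB.instance Definition _ := isMetric.Build R D_infty
  d_inftyxx d_infty_positivity d_infty_sym d_infty_triangle.

(* D([0, t[, R^d). The proof of 0 < t is only there for the metric, which is
   defined through the bijection alpha : [0, t[ -> [0, +oo[. *)
Definition D_before (t : R) (t0 : 0 < t) : Type := D `[0, t[.

HB.instance Definition _ (t : R) (t0 : 0 < t) := Choice.on (D_before t0).

Section TimeHorizon.
Context (t : R) (t0 : 0 < t).

Lemma alpha_subproof (u : `[0, t[%classic) :
  val u / (t - val u) \in `[(0 : R), +oo[%classic.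
Proof.
have := set_mem (valP u); rewrite inE /= !in_itv /= => /andP[u0 ut].
by rewrite andbT divr_ge0// subr_ge0 ltW.
Qed.

Definition alpha (u : `[0, t[%classic) : `[(0 : R), +oo[%classic :=
  exist _ (val u / (t - val u)) (alpha_subproof u).

Lemma alpha_inv_subproof (v : `[(0 : R), +oo[%classic) :
  t * val v / (1 + val v) \in `[0, t[%classic.
Proof.
have := set_mem (valP v); rewrite inE /= !in_itv /= andbT => v0.
have v1 : 0 < 1 + val v by rewrite ltr_wpDr.
apply/andP; split; last by rewrite ltr_pdivrMr// ltr_pM2l// ltrDr.
by rewrite divr_ge0 ?mulr_ge0// ltW.
Qed.

Definition alpha_inv (v : `[(0 : R), +oo[%classic) : `[0, t[%classic :=
  exist _ (t * val v / (1 + val v)) (alpha_inv_subproof v).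

Lemma alphaK : cancel alpha alpha_inv.
Proof.
move=> u; apply: val_inj => /=.
have := set_mem (valP u); rewrite /= in_itv /= => /andP[u0 ut].
have tu : t - val u != 0 by rewrite subr_eq0 gt_eqF.
by field; rewrite tu subrK gt_eqF.
Qed.

Lemma alpha_invK : cancel alpha_inv alpha.
Proof.
move=> v; apply: val_inj => /=.
have := set_mem (valP v); rewrite /= in_itv /= andbT; move: (\val v) => w w0.
have w1 : 1 + w != 0 by rewrite gt_eqF// ltr_wpDr.
have tN0 : t != 0 by rewrite gt_eqF.
have -> : t - t * w / (1 + w) = t / (1 + w) by field.
by rewrite invf_div; field; rewrite tN0 w1.
Qed.

Lemma alpha_inv_continuous : continuous alpha_inv.
Proof.
apply: continuous_set_type => v.
have v1 : 1 + val v != 0.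
  have := set_mem (valP v); rewrite /= in_itv /= andbT => v0.
  by rewrite gt_eqF// ltr_wpDr.
have cg : {for val v, continuous (fun w : R => t * w / (1 + w))}.
  apply: cvgM; first by apply: cvgMl_tmp; exact: cvg_id.
  by apply: cvgV => //; apply: cvgD; [exact: cvg_cst|exact: cvg_id].
exact: (continuous_comp (@val_continuous R _ v) cg).
Qed.

Lemma alpha_inv_lt u v : val u < val v -> val (alpha_inv u) < val (alpha_inv v).
Proof.
have := set_mem (valP u); rewrite /= in_itv /= andbT => u0 uv.
have v0 := le_lt_trans u0 uv.
have u1 : 0 < 1 + val u by rewrite ltr_wpDr.
have v1 : 0 < 1 + val v by rewrite ltr_wpDr// ltW.
suff : t * val u / (1 + val u) < t * val v / (1 + val v) by [].
rewrite ltr_pdivrMr// mulrAC ltr_pdivlMr//.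
have : t * val u < t * val v by rewrite ltr_pM2l.
by lra.
Qed.

Local Notation D_before := (D_before t0).

Definition rescale : D_before -> D_infty :=
  D_comp alpha_inv_continuous alpha_inv_lt.

Definition d_hat (x y : D_before) : R := d_infty (rescale x) (rescale y).

Lemma d_hatxx x : d_hat x x = 0. Proof. exact: d_inftyxx. Qed.

Lemma d_hat_positivity x y : d_hat x y = 0 -> x = y.
Proof.
move=> /d_infty_positivity/(congr1 val) xy; apply/val_inj/funext => u.
have /(congr1 (fun f => f (alpha u))) : val x \o alpha_inv = val y \o alpha_inv.
  exact: xy.
by rewrite /= alphaK.
Qed.

Lemma d_hat_sym x y : d_hat x y = d_hat y x.
Proof. exact: d_infty_sym. Qed.

Lemma d_hat_triangle y x z : d_hat x z <= d_hat x y + d_hat y z.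
Proof. exact: d_infty_triangle. Qed.

HB.instance Definition _ := isMetric.Build R D_before
  d_hatxx d_hat_positivity d_hat_sym d_hat_triangle.

End TimeHorizon.

Section Restriction.
Context (t : R).

Lemma subset_segment : `[0, t]%classic `<=` `[(0 : R), +oo[%classic.
Proof. by move=> s /=; rewrite !in_itv/= => /andP[->]. Qed.

Lemma subset_before : `[0, t[%classic `<=` `[(0 : R), +oo[%classic.
Proof. by move=> s /=; rewrite !in_itv/= => /andP[->]. Qed.

Lemma restrict_C0_subproof (x : C0 `[0, +oo[) :
  val x \o inclusion subset_segment \in
    [set y : {family compact, `[0, t]%classic -> 'rV[R]_d} |
      continuous (y : `[0, t]%classic -> 'rV[R]_d) /\
      forall u : `[0, t]%classic, val u = 0 -> y u = 0].
Proof.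
have [cx x0] := set_mem (valP x); apply/mem_set; split=> [u|u u0].
  by apply: continuous_comp; [exact: inclusion_continuous|exact: cx].
by apply: x0.
Qed.

Definition restrict_C0 (x : C0 `[0, +oo[) : C0 `[0, t] :=
  exist _ (val x \o inclusion subset_segment) (restrict_C0_subproof x).

Definition restrict_D (t0 : 0 < t) : D_infty -> D_before t0 :=
  D_comp (@inclusion_continuous R _ _ subset_before) (fun u v uv => uv).

End Restriction.

End PathSpaces.

Arguments C0 R d I : clear implicits.
Arguments D_infty R d : clear implicits.
Arguments D_before R d {t} t0.

(* Main.v *)
(* Composition with a continuous map of dense range is an isometric embedding of
   the spaces of bounded continuous functions, so it suffices to see that the
   restriction of paths is such a map. In the continuous case it is even onto,
   since a path on [0, t] can be stopped at t. In the cadlag case a path on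
   [0, t[ need not have a left limit at t, but it is approximated by paths that
   extend to [0, +oo[ and agree with it on [0, c], c close to t. Continuity comes
   from rescaling the time changes of a large interval [0, N] to [0, t[; thanks
   to the cutoffs in the J1 metric, what they do near the right end of the
   rescaled interval [0, m] is irrelevant. *)
From HB Require Import structures.
Require Import Defs.
From mathcomp Require Import all_boot all_order all_algebra.
From mathcomp Require Import all_classical all_reals all_analysis.
From mathcomp Require Import ring lra.

Set Implicit Arguments.
Unset Strict Implicit.
Unset Printing Implicit Defensive.

Import Order.TTheory GRing.Theory Num.Theory.
Import numFieldNormedType.Exports.

Local Open Scope classical_set_scope.
Local Open Scope ring_scope.

(** * Pullback along a continuous map of dense range *)

Section Pullback.
Context {R : realType} {X Y : topologicalType} (r : X -> Y).

Lemma Cb_continuous (Z : topologicalType) (f : Cb R Z) : continuous f.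
Proof. by case: f => f /=; rewrite inE => -[]. Qed.

Lemma Cb_bounded (Z : topologicalType) (f : Cb R Z) :
  has_ubound (range (fun x => `|f x|)).
Proof.
(* [bounded_fun] only provides the bounds strictly above its threshold [M], whence [|M| + 1]. *)
case: f => f /=; rewrite inE => -[_ [M [Mr fM]]]; exists (`|M| + 1) => _ [x _ <-].
by apply: fM => //=; rewrite (le_lt_trans (ler_norm M))// ltrDl.
Qed.

Hypothesis cr : continuous r.

Lemma pullback_subproof (f : Cb R Y) : f \o r \in @Cb_pred R X.
Proof.
rewrite inE; split.
  by move=> x; apply: continuous_comp; [exact: cr|exact: Cb_continuous].
have [M fM] := Cb_bounded f; exists M; split=> [|N MN x _ /=].
  exact: num_real.
by apply: le_trans (ltW MN); apply: fM; exists (r x).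
Qed.

Definition pullback (f : Cb R Y) : Cb R X := MkCb (pullback_subproof f).

Lemma pullback_linear : linear pullback.
Proof. by move=> a f g; apply/val_inj. Qed.

HB.instance Definition _ :=
  GRing.isLinear.Build R (Cb R Y) (Cb R X) _ pullback pullback_linear.

Hypothesis dr : dense (range r).

Lemma supnorm_pullback (f : Cb R Y) : supnorm (pullback f) = supnorm f.
Proof.
(* Suprema need nonempty sets, so an empty [X] is treated apart; density then forces [Y] to be empty
   too. *)
have [x0|/forallNP X0] := pselect (exists x : X, True); last first.
  have Y0 (y : Y) : False.
    have [|_ [_ [x _ _]]] := dr _ (@openT Y); first by exists y.
    exact: (X0 x).
  by congr sup; apply/seteqP; split=> z [w _ _]; [case: (X0 w)|case: (Y0 w)].
have [x _] := x0; apply/eqP; rewrite eq_le; apply/andP; split.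
  apply: ge_sup; first by exists `|f (r x)|, x.
  by move=> _ [z _ <-]; apply: ub_le_sup (Cb_bounded f) _ _; exists (r z).
apply: ge_sup; first by exists `|f (r x)|, (r x).
move=> _ [y _ <-]; rewrite leNgt; apply/negP => fy.
(* This open set contains [y], so by density it meets the range of [r], where [|f|] is at most the
   norm of the pullback. *)
have oU : open [set z | supnorm (pullback f) < `|f z|].
  apply: (@open_comp _ _ (fun z => `|f z|) [set u | _ < u]); last exact: open_gt.
  by move=> z _; apply: continuous_comp; [exact: Cb_continuous|exact: norm_continuous].
have [|w [/= fw [z _ zw]]] := dr _ oU; first by exists y.
move: fw; apply/negP; rewrite -leNgt -zw.
by apply: ub_le_sup (Cb_bounded (pullback f)) _ _; exists z.
Qed.

Lemma pullback_isometry :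
  exists J : {linear Cb R Y -> Cb R X},
    [/\ forall f x, J f x = f (r x),
        forall f g, supnorm (J f - J g) = supnorm (f - g) &
        injective J].
Proof.
exists pullback; split => // [f g|f g fg].
  by rewrite -(linearB (pullback : {linear _ -> _})) supnorm_pullback.
apply/eqP; rewrite -subr_eq0; apply/eqP/val_inj/funext => y /=.
apply/eqP; rewrite -normr_le0.
(* Injectivity follows from the isometry: the two pullbacks agree, so [f - g] has norm 0. *)
have -> : 0 = supnorm (f - g).
  rewrite -supnorm_pullback (_ : pullback _ = 0) ?/supnorm; last first.
    by apply: val_inj; have /(congr1 val) := subrr (pullback g); rewrite -{1}fg.
  (* The range is empty when [X] is; the default value of [sup] on the empty set is 0 as well. *)
  have /subset_set1[->|->] : range (fun x => `|(0 : Cb R X) x|) `<=` [set 0].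
    by move=> _ [x _ <-] /=; rewrite normr0.
  - by rewrite sup0.
  - by rewrite sup1.
by apply: ub_le_sup (Cb_bounded (f - g)) _ _; exists y.
Qed.

End Pullback.

(** * Continuous case: restriction to [0, t] is continuous and onto *)

Section ContinuousPaths.
Context {R : realType} (d : nat) (t : R).

(** The inclusion carries a compact subset of [0, t] to a compact subset of [0, +oo[, and uniform
    closeness of two paths on the latter is uniform closeness of their restrictions on the
    former. *)
Lemma restrict_C0_continuous : continuous (@restrict_C0 R d t).
Proof.
apply: (@continuous_comp_initial _ _ _ set_val) => x.
have -> : set_val \o @restrict_C0 R d t =
    (fun y => set_val y \o inclusion (@subset_segment R t)).
  by rewrite set_valE.
have FF : Filter (nbhs x) := nbhs_filter x.
have FG := fmap_filter (fun y : C0 R d `[0, +oo[ => set_val y \o inclusion (@subset_segment R t)) FF.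
apply: (iffRL (fam_cvgP _ _ FG)) => A cA P /uniform_nbhs[E [entE EP]].
have cB : compact (inclusion (@subset_segment R t) @` A).
  apply: continuous_compact cA.
  by apply: continuous_subspaceT; exact: inclusion_continuous.
have := @initial_continuous _ _ (@set_val _ _ : C0 R d `[0, +oo[ -> _) x.
move=> /(fam_cvgP _ _ _)/(_ _ cB)/(_ [set y | forall u,
  (inclusion (@subset_segment R t) @` A) u -> E (set_val x u, y u)]) h.
suff : nbhs x [set y : C0 R d `[0, +oo[ | forall u,
  (inclusion (@subset_segment R t) @` A) u -> E (set_val x u, set_val y u)].
  by apply: filterS => y xyE; apply: EP => u Au; apply: xyE; exists u.
by apply: h; apply/uniform_nbhs; exists E; split.
Qed.

Hypothesis t0 : 0 < t.

Lemma stop_subproof (u : `[(0 : R), +oo[%classic) : Num.min (val u) t \in `[0, t]%classic.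
Proof.
have := set_mem (valP u); rewrite /= in_itv/= andbT => u0.
by apply/mem_set; rewrite /= in_itv/= le_min u0 ltW//= ge_min lexx orbT.
Qed.

Definition stop (u : `[(0 : R), +oo[%classic) : `[0, t]%classic :=
  exist _ (Num.min (val u) t) (stop_subproof u).

Lemma stop_continuous : continuous stop.
Proof.
apply: continuous_set_type => u.
by apply: continuous_min; [exact: val_continuous|exact: cst_continuous].
Qed.

Lemma inclusionK_stop : cancel (inclusion (@subset_segment R t)) stop.
Proof.
move=> u; apply: val_inj => /=; apply: min_l.
by have := set_mem (valP u); rewrite /= in_itv/= => /andP[].
Qed.

Lemma extend_subproof (y : C0 R d `[0, t]) :
  val y \o stop \in [set x : {family compact, `[(0 : R), +oo[%classic -> 'rV[R]_d} |
    continuous (x : `[(0 : R), +oo[%classic -> 'rV[R]_d) /\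
    forall u : `[(0 : R), +oo[%classic, val u = 0 -> x u = 0].
Proof.
have [cy y0] := set_mem (valP y); apply/mem_set; split=> [u|u u0].
  by apply: continuous_comp; [exact: stop_continuous|exact: cy].
by apply: y0; rewrite /= u0 min_l// ltW.
Qed.

Lemma restrict_C0_surjective (y : C0 R d `[0, t]) : exists x, restrict_C0 t x = y.
Proof.
exists (exist _ (val y \o stop) (extend_subproof y)).
by apply/val_inj/funext => u; rewrite /= inclusionK_stop.
Qed.

Lemma restrict_C0_dense : dense (range (@restrict_C0 R d t)).
Proof.
move=> O [y Oy] _; exists y; split => //.
by have [x xy] := restrict_C0_surjective y; exists x.
Qed.

End ContinuousPaths.

(** * The bijection between [0, +oo[ and [0, t[, and gluing of time changes *)

Section TimeScale.
Context {R : realType}.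
Implicit Types s u v m p t : R.

(** The formulas of [alpha_inv] and [alpha], on plain reals so that they compose with time changes,
    which are functions on [R]. *)
Definition compress t s := t * s / (1 + s).
Definition decompress t u := u / (t - u).

Lemma compress_ge0 t s : 0 <= t -> 0 <= s -> 0 <= compress t s.
Proof. by move=> t0 s0; rewrite divr_ge0 ?mulr_ge0// addr_ge0. Qed.

Lemma decompress_ge0 t u : 0 <= u -> u < t -> 0 <= decompress t u.
Proof. by move=> u0 ut; rewrite divr_ge0// subr_ge0 ltW. Qed.

Lemma sub_compress t s : 0 <= s -> t - compress t s = t / (1 + s).
Proof. by move=> s0; rewrite /compress; field; rewrite gt_eqF// ltr_pwDl. Qed.

Lemma compress_lt t s : 0 < t -> 0 <= s -> compress t s < t.
Proof. by move=> t0 s0; rewrite -subr_gt0 sub_compress// divr_gt0// ltr_pwDl. Qed.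

Lemma compressK t s : 0 < t -> 0 <= s -> decompress t (compress t s) = s.
Proof.
move=> t0 s0; rewrite /decompress sub_compress// /compress.
by field; rewrite !gt_eqF// ltr_pwDl.
Qed.

Lemma decompressK t u : 0 < t -> u < t -> compress t (decompress t u) = u.
Proof.
move=> t0 ut; rewrite /compress /decompress; field.
by rewrite subr_eq0 gt_eqF//= subrK gt_eqF.
Qed.

Lemma decompress_lt t u v : 0 < t -> u < v -> v < t -> decompress t u < decompress t v.
Proof.
move=> t0 uv vt; have ut := lt_trans uv vt; rewrite /decompress ltr_pdivrMr ?subr_gt0//.
rewrite mulrAC ltr_pdivlMr ?subr_gt0//.
have : t * u < t * v by rewrite ltr_pM2l.
by lra.
Qed.

Lemma compress_incr t s u : 0 < t -> 0 <= s -> s < u -> compress t s < compress t u.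
Proof.
move=> t0 s0 su; have [s1 u1] : 0 < 1 + s /\ 0 < 1 + u by split; lra.
rewrite /compress ltr_pdivrMr// mulrAC ltr_pdivlMr//.
have : t * s < t * u by rewrite ltr_pM2l.
by lra.
Qed.

Lemma compress_le t s u : 0 < t -> 0 <= s -> s <= u -> compress t s <= compress t u.
Proof.
by move=> t0 s0; rewrite le_eqVlt => /predU1P[->//|su]; rewrite ltW// compress_incr.
Qed.

(** The difference [decompress t u - s] is [u - compress t s] times [(1 + s) / (t - u)], and this
    factor is at most [2 * (1 + m) ^+ 2 / t] once [u] stays away from [t]. *)
Lemma decompress_compress_dist t s u h m : 0 < t -> 0 <= s <= m -> u < t ->
  0 <= h <= 1 -> `|u - compress t s| <= h * t / (2 * (1 + m) ^+ 2) ->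
  `|decompress t u - s| <= h.
Proof.
move=> t0 /andP[s0 sm] ut /andP[h0 h1] us.
have M1 : 1 <= 1 + m by rewrite lerDl (le_trans s0).
have M0 : 0 < 1 + m by lra.
have S0 : 0 < 1 + s by lra.
(* The gap between [compress t s] and [t] is at least [t / (1 + m)], and moving to [u] loses at most
   half of that. *)
have tu : t / (2 * (1 + m)) <= t - u.
  have cs : t / (1 + m) <= t - compress t s.
    by rewrite sub_compress// ler_pM2l// lef_pV2 ?posrE// lerD2l.
  have ht : h * t / (2 * (1 + m) ^+ 2) <= t / (2 * (1 + m)).
    rewrite ler_pdivrMr ?mulr_gt0 ?exprn_gt0//.
    have -> : t / (2 * (1 + m)) * (2 * (1 + m) ^+ 2) = t * (1 + m).
      by field; rewrite gt_eqF.
    by rewrite mulrC ler_pM2l//; lra.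
  have e2 : t / (1 + m) = 2 * (t / (2 * (1 + m))) by field; rewrite gt_eqF.
  by move: us; rewrite ler_norml => /andP[_ us]; lra.
have tu0 : 0 < t - u by rewrite subr_gt0.
have -> : decompress t u - s = (u - compress t s) * ((1 + s) / (t - u)).
  rewrite /decompress /compress; field.
  by rewrite !gt_eqF.
have r0 : 0 <= (1 + s) / (t - u) by rewrite divr_ge0// ltW.
rewrite normrM [X in _ * X]ger0_norm//.
have q : (1 + s) / (t - u) <= 2 * (1 + m) ^+ 2 / t.
  rewrite ler_pdivrMr// mulrAC ler_pdivlMr//.
  have : (2 * (1 + m) ^+ 2) * (t / (2 * (1 + m))) <= (2 * (1 + m) ^+ 2) * (t - u).
    by rewrite ler_pM2l// mulr_gt0// exprn_gt0.
  have -> : (2 * (1 + m) ^+ 2) * (t / (2 * (1 + m))) = t * (1 + m).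
    by field; rewrite gt_eqF.
  by nra.
apply: (le_trans (ler_pM (normr_ge0 _) r0 us q)).
by rewrite le_eqVlt; apply/orP; left; apply/eqP; field; rewrite !gt_eqF.
Qed.

(** [f] maps [0, p] increasingly onto [0, f p], and the affine piece maps [p, m] onto [f p, m] with
    positive slope. Continuity comes for free, since an increasing surjection of an interval is
    continuous. *)
Lemma time_change_glue p m (f : R -> R) : 0 <= p < m ->
  (forall s, 0 <= s <= p -> 0 <= f s) ->
  (forall s u, 0 <= s -> s < u -> u <= p -> f s < f u) ->
  (forall v, 0 <= v <= f p -> exists2 s, 0 <= s <= p & f s = v) ->
  f p < m ->
  time_change m
    (fun s => if s <= p then f s else f p + (s - p) * ((m - f p) / (m - p))).
Proof.
move=> /andP[p0 pm] f0 fi fs fpm; have m0 : 0 <= m by lra.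
set c := (m - f p) / (m - p).
have c0 : 0 < c by rewrite divr_gt0 ?subr_gt0.
have cE : (m - p) * c = m - f p by rewrite /c; field; rewrite subr_eq0 gt_eqF.
have fle s : 0 <= s <= p -> f s <= f p.
  move=> /andP[s0]; rewrite le_eqVlt => /orP[/eqP->//|sp].
  by rewrite ltW// fi.
apply: time_change_build => //.
  move=> s u; rewrite !in_itv/= => /andP[s0 sm] /andP[u0 um] su.
  have [sp|ps] := leP s p; have [up|pu] := leP u p.
  - exact: fi.
  - by rewrite (le_lt_trans (fle _ _)) ?s0// ltrDl mulr_gt0 ?subr_gt0.
  - by lra.
  - by rewrite ltrD2l ltr_pM2r// ltrD2r.
apply/seteqP; split=> [_ [s /= + <-]|v /=]; rewrite !in_itv/= => /andP[].
  move=> s0 sm; have [sp|ps] := leP s p.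
    have ss : 0 <= s <= p by rewrite s0.
    by rewrite f0//= (le_trans (fle _ ss))// ltW.
  have fp0 : 0 <= f p by rewrite f0// p0 lexx.
  have sc0 : 0 <= (s - p) * c by rewrite mulr_ge0// ?subr_ge0 ltW.
  have : (s - p) * c <= (m - p) * c by rewrite ler_pM2r// lerD2r.
  by rewrite cE => h; apply/andP; split; lra.
move=> v0 vm; have [vfp|fpv] := leP v (f p).
  have [|s /andP[s0 sp] sv] := fs v; first by rewrite v0.
  exists s; last by rewrite sp.
  by rewrite /= in_itv/= s0; lra.
exists (p + (v - f p) / c).
  have vc0 : 0 <= (v - f p) / c by rewrite divr_ge0// ?subr_ge0 ltW.
  rewrite /= in_itv/= addr_ge0//=.
  by rewrite -lerBrDl ler_pdivrMr// cE lerD2r.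
rewrite -subr_ge0 opprD addrA subrr sub0r oppr_ge0 leNgt divr_gt0 ?subr_gt0//=.
by rewrite [p + _]addrC addrK divfK ?gt_eqF// addrC subrK.
Qed.

End TimeScale.

(** * Transfer of Skorokhod closeness from [0, N] to the rescaled interval [0, m] *)

Section Rescaling.
Context {R : realType} {V : normedModType R}.
Implicit Types (X Y : R -> V) (s u e t : R) (m N : nat).

Lemma cutoff_lipschitz m s u : `|cutoff m s - cutoff m u| <= `|s - u|.
Proof.
rewrite /cutoff; move: (m%:R : R) => M.
rewrite /Order.max /Order.min.
case: (ltP 1 (M - s)) => ?; case: (ltP 1 (M - u)) => ?; rewrite ?ltr01;
  case: (ltP 0 (M - s)) => ?; case: (ltP 0 (M - u)) => ?;
  case: (ler0P (s - u)) => ?; rewrite ler_norml; apply/andP; split; lra.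
Qed.

Lemma cutoff_le_sub m s : s <= m%:R -> cutoff m s <= m%:R - s.
Proof. by move=> sm; rewrite /cutoff ge_max subr_ge0 sm/= ge_min lexx orbT. Qed.

Lemma skorokhod_eps_le T X Y e e' : e <= e' ->
  skorokhod_eps T X Y e -> skorokhod_eps T X Y e'.
Proof.
move=> ee' [e0 [l tl lP]]; split; first exact: lt_le_trans ee'.
by exists l => // s /lP[le1 le2]; split; exact: le_trans ee'.
Qed.

(* The rescaled time change [decompress t \o l \o compress t] need not preserve the
   interval [0, m], so it is made affine on a short interval [p, m], on which the
   cutoff is small. *)
Lemma skorokhod_eps_compress t B e m N : 0 < t -> t <= N%:R -> 0 <= B ->
  0 < e -> (0 < m)%N ->
  exists2 h, 0 < h & forall X Y,
    (forall s, s \in `[0, N%:R] -> `|X s| <= B) ->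
    skorokhod_eps N%:R X Y h ->
    skorokhod_eps m%:R (fun s => cutoff m s *: X (compress t s))
                       (fun s => cutoff m s *: Y (compress t s)) e.
Proof.
move=> t0 tN B0 e0 m0; have m1 : 1 <= m%:R :> R by rewrite ler1n.
set M : R := m%:R in m1 *.
(* [rho] is the length of the interval [p, m]; a cutoff of order [rho] times a path bounded by
   [B + 1] is then of order [e / 4]. *)
pose rho := Num.min (1 / 2) (e / (4 * (B + 1))).
have B1 : 0 < B + 1 by lra.
have rho0 : 0 < rho by rewrite lt_min !divr_gt0// mulr_gt0.
have rho1 : rho <= 1 / 2 by rewrite ge_min lexx.
have rhoB : rho * (B + 1) <= e / 4.
  have : rho <= e / (4 * (B + 1)) by rewrite ge_min lexx orbT.
  by rewrite ler_pdivlMr ?mulr_gt0//; lra.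
have rhoe : rho <= e / 4.
  by apply: le_trans rhoB; rewrite ler_peMr//; lra.
(* The bound of [decompress_compress_dist] for a displacement of [rho / 2] in the decompressed
   time. *)
pose q := (rho / 2) * t / (2 * (1 + M) ^+ 2).
have q0 : 0 < q by rewrite !(divr_gt0, mulr_gt0, exprn_gt0)//; lra.
(* The three bounds serve, in order, to bound [Y] by [B + 1], to compare the values of the paths,
   and to compare times. *)
pose h := Num.min 1 (Num.min (e / 2) q).
have [h1 he hq] : [/\ h <= 1, h <= e / 2 & h <= q].
  by split; rewrite /h !ge_min lexx ?orbT.
exists h; first by rewrite !lt_min ltr01 q0 divr_gt0.
move=> X Y XB [h0 [l tl lP]]; split => //.
pose p := M - rho.
have pM : 0 <= p < M by rewrite /p; apply/andP; split; lra.
have cN s : 0 <= s -> compress t s \in `[0, N%:R].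
  move=> s0; rewrite in_itv/= compress_ge0 ?(ltW t0)//=.
  by rewrite (le_trans _ tN)// ltW// compress_lt.
pose f s := decompress t (l (compress t s)).
have lN s : 0 <= s -> 0 <= l (compress t s).
  by move=> /cN/(time_change_in tl); rewrite in_itv/= => /andP[].
have near s : 0 <= s <= M -> `|l (compress t s) - compress t s| <= q.
  by move=> /andP[/cN/lP[+ _] _] => /le_trans; apply.
(* [l] is a time change of [0, N], which may reach past [t]; but [q] is smaller than the gap between
   [compress t s] and [t]. *)
have lt s : 0 <= s <= M -> l (compress t s) < t.
  move=> /andP[s0 sM]; have := near s; rewrite s0 sM => /(_ isT).
  rewrite ler_norml => /andP[_]; have := sub_compress t s0.
  have : t / (1 + M) <= t / (1 + s) by rewrite ler_pM2l// lef_pV2 ?posrE; lra.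
  have : q < t / (1 + M).
    rewrite ltr_pdivlMr; last by lra.
    have -> : q * (1 + M) = t * (rho / 4 / (1 + M)) by rewrite /q; field; lra.
    by rewrite -[ltRHS]mulr1 ltr_pM2l// ltr_pdivrMr; lra.
  by lra.
have fs s : 0 <= s <= M -> `|f s - s| <= rho / 2.
  move=> sM; apply: (@decompress_compress_dist _ _ _ _ _ M) => //; first exact: lt.
    by apply/andP; split; lra.
  exact: near.
have [il _ lT] := tl.
have finc s u : 0 <= s -> s < u -> u <= M -> f s < f u.
  move=> s0 su uM; have u0 : 0 <= u by lra.
  apply: decompress_lt => //; last by apply: lt; rewrite u0.
  by apply: il; [exact: cN|exact: cN|exact: compress_incr].
have pM' : 0 <= p <= M by rewrite /p; apply/andP; split; lra.
have [p0 pltM] := andP pM.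
(* The displacement [rho / 2] is less than [M - p], which leaves room for an increasing affine
   piece. *)
have fpM : f p < M.
  by have := fs p pM'; rewrite ler_norml /p => /andP[_]; lra.
have fonto v : 0 <= v <= f p -> exists2 s, 0 <= s <= p & f s = v.
  move=> /andP[v0 vp].
  have [w wN wv] := time_change_onto tl (cN _ v0).
  have wp : w <= compress t p.
    rewrite -(le_mono_in il)//; last exact: cN.
    rewrite wv -[leRHS](decompressK t0); last exact: lt.
    exact: compress_le.
  have wt : w < t by rewrite (le_lt_trans wp)// compress_lt.
  have w0 : 0 <= w by move: wN; rewrite in_itv/= => /andP[].
  exists (decompress t w).
    rewrite decompress_ge0//= leNgt; apply/negP => /(compress_incr t0 p0).
    by rewrite decompressK// ltNge wp.
  by rewrite /f decompressK// wv compressK.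
have f0 s : 0 <= s <= p -> 0 <= f s.
  move=> /andP[s0 sp]; apply: decompress_ge0; first exact: lN.
  by apply: lt; rewrite s0 (le_trans sp)// ltW.
have finc' s u : 0 <= s -> s < u -> u <= p -> f s < f u.
  by move=> s0 su up; apply: finc => //; rewrite (le_trans up)// ltW.
have tk := time_change_glue pM f0 finc' fonto fpM.
exists (fun s => if s <= p then f s else f p + (s - p) * ((M - f p) / (M - p))) => //.
move=> s sM; have := time_change_in tk sM.
(* Since [l] is onto, every value of [Y] on [0, N] is within [h], hence within 1, of a value of
   [X]. *)
have YB u : 0 <= u -> `|Y (compress t u)| <= B + 1.
  move=> /cN/(time_change_onto tl)[w wN <-].
  have [_ xy] := lP _ wN.
  have := ler_normB (X w) (X w - Y (l w)); rewrite subKr => /le_trans; apply.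
  by apply: lerD; [exact: XB|exact: le_trans h1].
have XB' u : 0 <= u -> `|X (compress t u)| <= B by move=> /cN/XB.
move: sM; rewrite !in_itv/= => /andP[s0 sM].
have [sp _|ps /andP[k0 kM]] := leP s p.
  have ss : 0 <= s <= M by rewrite s0.
  split; first by apply: le_trans (fs _ ss) _; lra.
  (* The change of path costs at most [e / 2], and the change of cutoff at most [rho / 2] times
     [B + 1]. *)
  have -> : cutoff m s *: X (compress t s) - cutoff m (f s) *: Y (compress t (f s)) =
      cutoff m s *: (X (compress t s) - Y (compress t (f s))) +
      (cutoff m s - cutoff m (f s)) *: Y (compress t (f s)).
    by rewrite scalerBr scalerBl addrA subrK.
  apply: (le_trans (ler_normD _ _)); rewrite !normrZ.
  have fs0 : 0 <= f s by rewrite f0// s0.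
  have c1 : `|cutoff m s - cutoff m (f s)| <= rho / 2.
    by rewrite (le_trans (cutoff_lipschitz _ _ _))// distrC fs.
  have := ler_pM (normr_ge0 _) (normr_ge0 _) c1 (YB _ fs0).
  have [_] := lP _ (cN _ s0); rewrite -[X in Y X](decompressK t0) -/(f s); last exact: lt.
  rewrite ger0_norm ?cutoff_ge0// => xy.
  have := ler_pM (cutoff_ge0 m s) (normr_ge0 _) (cutoff_le1 m s) xy.
  by lra.
(* Beyond [p], both [s] and its image [k] lie within [3 / 2 * rho] of [M]. Times are therefore close
   and both cutoffs small, so the bounds [XB'] and [YB] suffice. *)
move: k0 kM; set k := f p + _ => k0 kM.
have kp : f p <= k.
  by rewrite /k lerDl mulr_ge0 ?divr_ge0// ?subr_ge0 ltW.
have fp : p - rho / 2 <= f p.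
  by have := fs p pM'; rewrite ler_norml => /andP[]; lra.
split; first by rewrite ler_norml /p in ps fp *; apply/andP; split; lra.
apply: (le_trans (ler_normB _ _)); rewrite !normrZ !ger0_norm ?cutoff_ge0//.
have cs : cutoff m s <= rho.
  by rewrite (le_trans (cutoff_le_sub sM))//; move: ps; rewrite /p /M; lra.
have ck : cutoff m k <= 3 / 2 * rho.
  by rewrite (le_trans (cutoff_le_sub kM))//; move: fp kp; rewrite /p /M; lra.
have := ler_pM (cutoff_ge0 m s) (normr_ge0 _) cs (XB' _ s0).
have := ler_pM (cutoff_ge0 m k) (normr_ge0 _) ck (YB _ k0).
by nra.
Qed.

End Rescaling.

(** * Comparison of the J1 metric with the distances on bounded intervals *)

Section SkorokhodMetricBounds.
Context {R : realType} {V : normedModType R}.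
Implicit Types x y : `[(0 : R), +oo[%classic -> V.

Lemma skorokhod_term_le_metric x y m :
  skorokhod_term x y m.+1 <= skorokhod_metric x y.
Proof.
apply: (@le_trans _ _ (series (fun m => skorokhod_term x y m.+1) m.+1)).
  by rewrite /series/= big_nat_recr//= lerDr sumr_ge0// => i _; exact: skorokhod_term_ge0.
apply: nondecreasing_cvgn_le; last exact: is_cvg_skorokhod.
by apply: nondecreasing_series => n _ _; exact: skorokhod_term_ge0.
Qed.

(** The metric dominates its term of index [m.+1], and since [h <= 1] the truncation at 1 cannot be
    what makes this term small. *)
Lemma skorokhod_eps_of_metric x y m h : cadlag x -> cadlag y -> h <= 1 ->
  skorokhod_metric x y < h / 2 ^+ m.+1 ->
  skorokhod_eps m.+1%:R (cut_path m.+1 x) (cut_path m.+1 y) h.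
Proof.
move=> cx cy h1 xyh; have := le_lt_trans (skorokhod_term_le_metric x y m) xyh.
rewrite /skorokhod_term ltr_pM2r ?invr_gt0 ?exprn_gt0// gt_min ltNge h1/=.
move=> /(skorokhod_dist_lt (skorokhod_eps_cadlag m.+1 cx cy))[a xya /ltW ah].
exact: skorokhod_eps_le xya.
Qed.

(** The weights of the first [n] terms add up to less than 1, and the truncated tail adds up to at
    most [2 ^- n]. *)
Lemma skorokhod_metric_le x y n e : 0 <= e ->
  (forall m, (m < n)%N ->
    skorokhod_dist m.+1%:R (cut_path m.+1 x) (cut_path m.+1 y) <= e) ->
  skorokhod_metric x y <= e + 2 ^- n.
Proof.
move=> e0 xye; apply: limr_le; first exact: is_cvg_skorokhod.
set u := series _; have uS k : u k.+1 = u k + skorokhod_term x y k.+1.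
  by rewrite /u /series/= big_nat_recr.
have half k : 2 ^- k = 2 * (2 ^- k.+1) :> R.
  by rewrite exprS invfM mulrA divff ?mul1r.
have u_lt k : (k <= n)%N -> u k <= e * (1 - 2 ^- k).
  elim: k => [_|k IH kn]; first by rewrite /u /series/= big_geq// expr0 invr1 subrr mulr0.
  rewrite uS; have := IH (ltnW kn); rewrite (half k).
  have : skorokhod_term x y k.+1 <= e * 2 ^- k.+1.
    rewrite /skorokhod_term ler_wpM2r ?invr_ge0 ?exprn_ge0//.
    by rewrite ge_min xye// orbT.
  by lra.
(* The subtracted remainder of the geometric series makes the induction go through. *)
have u_ge j : u (n + j)%N <= e + 2 ^- n - 2 ^- (n + j).
  elim: j => [|j IH].
    by rewrite addn0 addrK (le_trans (u_lt n _))// ler_piMr// lerBlDr lerDl.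
  rewrite addnS uS; move: IH; rewrite (half (n + j)%N).
  have : skorokhod_term x y (n + j).+1 <= 2 ^- (n + j).+1.
    rewrite /skorokhod_term -[leRHS]mul1r ler_wpM2r ?invr_ge0 ?exprn_ge0//.
    by rewrite ge_min lexx.
  by lra.
near=> k.
have nk : (n <= k)%N by near: k; exists n.
by rewrite -(subnKC nk) (le_trans (u_ge _))// lerBlDr lerDl.
Unshelve. all: by end_near. Qed.

Lemma skorokhod_eps_eq T (X X' Y Y' : R -> V) e :
  {in `[0, T], X =1 X'} -> {in `[0, T], Y =1 Y'} ->
  skorokhod_eps T X Y e -> skorokhod_eps T X' Y' e.
Proof.
move=> XX YY [e0 [l tl lP]]; split => //; exists l => // s sT.
by rewrite -XX// -YY; [exact: lP|exact: time_change_in tl sT].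
Qed.

Lemma exists_half_expn (e : R) : 0 < e -> exists n : nat, 2 ^- n < e.
Proof.
move=> e0; exists (Num.truncn e^-1).+1.
rewrite -[ltRHS]invrK ltf_pV2 ?posrE ?invr_gt0 ?exprn_gt0//.
apply: lt_trans (truncnS_gt _) _.
by rewrite -natrX ltr_nat ltn_expl.
Qed.

End SkorokhodMetricBounds.

(** * Càdlàg case: restriction to [0, t[ is continuous with dense range *)

Section CadlagPaths.
Context {R : realType} (d : nat) (t : R) (t0 : 0 < t).

Lemma rescale_restrict (x : D_infty R d) s : 0 <= s ->
  'valL_0 (val (rescale (restrict_D t0 x))) s = 'valL_0 (val x) (compress t s).
Proof.
move=> s0; have [u us] := in_nneg s0; rewrite -us valL_val /=.
by rewrite -(valL_val 0).
Qed.

Lemma restrict_D_dist_near (x : D_infty R d) m e : 0 < e ->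
  \forall y \near x,
    skorokhod_dist m.+1%:R (cut_path m.+1 (val (rescale (restrict_D t0 x))))
                           (cut_path m.+1 (val (rescale (restrict_D t0 y)))) <= e.
Proof.
(* With [n.+1] above [t + 1], the cutoff of index [n.+1] is 1 on [0, t[, so the cut path there is
   the path itself. *)
move=> e0; pose n := Num.truncn (t + 1).
have tn : t + 1 < n.+1%:R by exact: truncnS_gt.
have [M xM] := cadlag_bounded n.+1%:R (D_cadlag x).
have tn' : t <= n.+1%:R by lra.
have [h h0 hP] := @skorokhod_eps_compress R 'rV[R]_d t `|M| e m.+1 n.+1
  t0 tn' (normr_ge0 _) e0 isT.
pose h' := Num.min h 1.
have h'0 : 0 < h' by rewrite lt_min h0 ltr01.
apply/nbhs_ballP; exists (h' / 2 ^+ n.+1) => /=.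
  by rewrite divr_gt0// exprn_gt0.
move=> y; rewrite ballEmdist => xy.
apply: skorokhod_dist_le.
have : skorokhod_eps n.+1%:R (cut_path n.+1 (val x)) (cut_path n.+1 (val y)) h.
  apply: (@skorokhod_eps_le _ _ _ _ _ h'); first by rewrite ge_min lexx.
  apply: skorokhod_eps_of_metric => //; try exact: D_cadlag.
  by rewrite ge_min lexx orbT.
have cutE (z : D_infty R d) : {in `[0, m.+1%:R],
    (fun s => cutoff m.+1 s *: cut_path n.+1 (val z) (compress t s)) =1
    cut_path m.+1 (val (rescale (restrict_D t0 z)))}.
  move=> s; rewrite in_itv/= => /andP[s0 _].
  rewrite /cut_path rescale_restrict// [cutoff n.+1 _]cutoff1 ?scale1r//.
  by have := compress_lt t0 s0; lra.
move=> xy_eps; apply: (skorokhod_eps_eq (cutE x) (cutE y)); apply: hP xy_eps.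
move=> s sN; rewrite normrZ ger0_norm ?cutoff_ge0//.
apply: le_trans (ler_norm M); apply: le_trans (xM _ sN).
by rewrite ler_piMl// cutoff_le1.
Qed.

(** Up to a tail below [e / 2], only finitely many distances count, and each is small on a
    neighbourhood of [x]. *)
Lemma restrict_D_continuous : continuous (@restrict_D R d t t0).
Proof.
move=> x P /nbhs_ballP[e /= e0 eP].
have e20 : 0 < e / 2 by rewrite divr_gt0.
have [n ne] := exists_half_expn e20.
have := filter_forall (nbhs_filter x)
  (fun m : 'I_n => restrict_D_dist_near x m e20).
apply: (@filterS _ _ (nbhs_filter x)) => y xy; apply: eP; rewrite ballEmdist/=.
have : d_hat (restrict_D t0 x) (restrict_D t0 y) <= e / 2 + 2 ^- n.
  apply: skorokhod_metric_le; first exact: ltW.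
  by move=> m mn; exact: (xy (Ordinal mn)).
by move=> /le_lt_trans; apply; lra.
Qed.

(** * An increasing map from [0, +oo[ to [0, t[ that fixes [0, c] *)

Section Squeeze.
Context (c : R) (c0 : 0 < c) (ct : c < t).

Let w s : R := Num.max 0 (s - c).

Let w0 s : 0 <= w s. Proof. by rewrite le_max lexx. Qed.

(* Stopping at c would not be strictly increasing, as [D_comp] requires, so
   [c, +oo[ is mapped onto [c, t[ instead. *)
Definition squeeze s : R := Num.min s c + compress (t - c) (w s).

Lemma squeeze_id s : s <= c -> squeeze s = s.
Proof.
move=> sc; rewrite /squeeze /w min_l// max_l ?subr_le0//.
by rewrite /compress mulr0 mul0r addr0.
Qed.

Lemma squeeze_subproof (u : `[(0 : R), +oo[%classic) :
  squeeze (val u) \in `[0, t[%classic.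
Proof.
have := set_mem (valP u); rewrite /= in_itv/= andbT => u0.
have tc : 0 < t - c by rewrite subr_gt0.
have := compress_lt tc (w0 (val u)).
have := compress_ge0 (ltW tc) (w0 (val u)).
have : Num.min (val u) c <= c by rewrite ge_min lexx orbT.
have : 0 <= Num.min (val u) c by rewrite le_min u0 ltW.
move=> *; apply/mem_set; rewrite /= in_itv/= /squeeze.
by apply/andP; split; lra.
Qed.

Definition squeeze_path (u : `[(0 : R), +oo[%classic) : `[0, t[%classic :=
  exist _ (squeeze (val u)) (squeeze_subproof u).

Lemma squeeze_path_lt u v : val u < val v -> val (squeeze_path u) < val (squeeze_path v).
Proof.
move=> /=; move: (val u) (val v) => a b ab; have tc : 0 < t - c by rewrite subr_gt0.
have [bc|cb] := leP b c; first by rewrite !squeeze_id//; lra.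
rewrite [ltRHS]/squeeze min_r ?ltW//.
have wb : 0 < w b by rewrite lt_max subr_gt0 cb orbT.
have [ac|ca] := leP a c.
  rewrite squeeze_id// (le_lt_trans ac)// ltrDl.
  by rewrite /compress divr_gt0 ?mulr_gt0// ltr_pwDl.
rewrite /squeeze min_r ?ltW// ltrD2l compress_incr// /w.
by rewrite !max_r ?subr_ge0 ?ltW// ltrD2r.
Qed.

Lemma squeeze_path_continuous : continuous squeeze_path.
Proof.
apply: continuous_set_type => u.
have cw : continuous (w : R -> R).
  move=> s; apply: (@continuous_max _ _ (cst 0) (fun s => s - c)); first exact: cst_continuous.
  by apply: cvgB; [exact: cvg_id|exact: cvg_cst].
have cs : {for val u, continuous squeeze}.
  apply: cvgD.
    by apply: (@continuous_min _ _ id (cst c)); [exact: cvg_id|exact: cst_continuous].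
  apply: cvgM; first by apply: cvgMl_tmp; exact: cw.
  apply: cvgV; first by rewrite gt_eqF// ltr_pwDl.
  by apply: cvgD; [exact: cvg_cst|exact: cw].
exact: (continuous_comp (@val_continuous R _ u) cs).
Qed.

End Squeeze.

Lemma restrict_D_dense : dense (range (@restrict_D R d t t0)).
Proof.
move=> O [y Oy] oO.
have /nbhs_ballP[e e0 yO] : nbhs y O by exact: open_nbhs_nbhs.
have [n ne] := exists_half_expn e0.
have n0 : (0 : R) < n.+1%:R by rewrite ltr0n.
(* Agreement on [0, c] becomes, after rescaling, agreement on [0, n + 1], which contains every
   interval [0, m + 1] with [m < n]. *)
pose c := compress t n.+1%:R.
have c0 : 0 < c by rewrite /c /compress divr_gt0 ?mulr_gt0// ltr_pwDl// ltW.
have ct : c < t by rewrite compress_lt// ltW.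
pose x : D_infty R d :=
  D_comp (@squeeze_path_continuous c c0 ct) (@squeeze_path_lt c c0 ct) y.
exists (restrict_D t0 x); split; last by exists x.
apply: yO; rewrite /= ballEmdist/=.
suff : d_hat y (restrict_D t0 x) <= 0 + 2 ^- n by rewrite add0r => /le_lt_trans; apply.
apply: skorokhod_metric_le => // m mn.
apply: (@le_trans _ _ (skorokhod_dist m.+1%:R (cut_path m.+1 (val (rescale y)))
    (cut_path m.+1 (val (rescale y))))); last by rewrite skorokhod_distxx.
(* [skorokhod_eps] has only positive members, so distance 0 is obtained from all [b > 0], each with
   the identity as time change. *)
apply/ler_addgt0Pl => b b0; rewrite skorokhod_distxx addr0.
apply: skorokhod_dist_le.
apply: (skorokhod_eps_eq _ _ (skorokhod_eps_refl _ _ b0)) => // s.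
rewrite in_itv/= => /andP[s0 sm]; rewrite /cut_path; congr (_ *: _).
have [u us] := in_nneg s0; rewrite -us !valL_val /=; congr (val y _).
apply: val_inj => /=; rewrite squeeze_id// us.
apply: compress_le => //; rewrite (le_trans sm)// ler_nat.
exact: (leq_trans mn).
Qed.

End CadlagPaths.

Theorem proposition3 (R : realType) (d : nat) (t : R) (t0 : 0 < t) :
  (exists J : {linear Cb R (C0 R d `[0, t]) -> Cb R (C0 R d `[0, +oo[)},
     [/\ forall f x, J f x = f (restrict_C0 t x),
         forall f g, supnorm (J f - J g) = supnorm (f - g) &
         injective J]) /\
  (exists J : {linear Cb R (D_before R d t0) -> Cb R (D_infty R d)},
     [/\ forall f x, J f x = f (restrict_D t0 x),
         forall f g, supnorm (J f - J g) = supnorm (f - g) &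
         injective J]).
Proof.
split; apply: pullback_isometry.
- exact: restrict_C0_continuous.
- exact: restrict_C0_dense.
- exact: restrict_D_continuous.
- exact: restrict_D_dense.
Qed.
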